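(* Let $E$ be an equivalence relation on $[\mathbb{N}]^{\mathbb{N}}$ such that for every $x \in [\mathbb{N}]^{\mathbb{N}}$ both of the following hold: (i) there exist almost disjoint $y, z \in [x]^{\mathbb{N}}$ such that $y \mathrel{E} z \mathrel{E} x$; and (ii) the restriction of $E$ to $[x]^{\mathbb{N}}$ has uncountably many equivalence classes. Then $E$ is not hypersmooth.
   Context: For an infinite set $x \subseteq \mathbb{N}$, $[x]^{\mathbb{N}}$ denotes the set of all infinite subsets of $x$; in particular $[\mathbb{N}]^{\mathbb{N}}$ is the set of infinite subsets of $\mathbb{N}$, with the Polish topology inherited from $2^{\mathbb{N}}$ via characteristic functions. Two sets $y, z \in [\mathbb{N}]^{\mathbb{N}}$ are almost disjoint if $y \cap z$ is finite. An equivalence relation $F$ on a standard Borel space $X$ is Borel reducible to an equivalence relation $F'$ on a standard Borel space $Y$ if there is a Borel map $\varphi : X \to Y$ with $a \mathrel{F} b \iff \varphi(a) \mathrel{F'} \varphi(b)$ for all $a,b \in X$. A Borel equivalence relation is smooth if it is Borel reducible to equality on $2^{\mathbb{N}}$. An equivalence relation is hypersmooth if it is the union of an increasing sequence $F_0 \subseteq F_1 \subseteq \cdots$ of smooth Borel equivalence relations; equivalently, if it is Borel reducible to the equivalence relation $E_1$ on $(2^{\mathbb{N}})^{\mathbb{N}}$ given by $(a_n)_n \mathrel{E_1} (b_n)_n \iff \exists m\ \forall n \geq m\ (a_n = b_n)$. *)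

(* Defs.v *)
From mathcomp Require Import all_boot.
From mathcomp Require Import boolp classical_sets functions cardinality.
From mathcomp Require Import topology measurable_structure cantor.
From Stdlib Require Export RelationClasses.

Set Implicit Arguments.
Unset Strict Implicit.
Unset Printing Implicit Defensive.

Local Open Scope classical_set_scope.

(* A standard Borel space is given through a (Polish) topology generating it. *)
Definition borel {X : topologicalType} : set (set X) :=
  <<s [set U : set X | open U] >>.

Definition borel_map {X Y : topologicalType} (f : X -> Y) : Prop :=
  forall B : set Y, borel B -> borel (f @^-1` B).

Definition borel_reducible {X Y : topologicalType}
    (F : X -> X -> Prop) (F' : Y -> Y -> Prop) : Prop :=
  exists2 phi : X -> Y, borel_map phi &
    forall a b : X, F a b <-> F' (phi a) (phi b).

Definition borel_equivalence {X : topologicalType} (F : X -> X -> Prop) : Prop :=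
  Equivalence F /\ borel [set p : X * X | F p.1 p.2].

Definition smooth {X : topologicalType} (F : X -> X -> Prop) : Prop :=
  borel_equivalence F /\ borel_reducible F (@eq cantor_space).

Definition hypersmooth {X : topologicalType} (E : X -> X -> Prop) : Prop :=
  exists F : nat -> X -> X -> Prop,
    [/\ forall n, smooth (F n),
        forall n x y, F n x y -> F n.+1 x y &
        forall x y, E x y <-> exists n, F n x y].

Definition restriction_classes {X : Type} (E : X -> X -> Prop) (A : set X) :
    set (set X) :=
  [set [set z | A z /\ E y z] | y in A].

Definition infinite_subsets : set cantor_space :=
  [set x | infinite_set [set n : nat | x n]].

(* As a type, a set carries the library's subspace topology ([set_type]); the
   topology of [infN] is thus the one inherited from [cantor_space]. *)
Notation infN := (set_type infinite_subsets).

Definition elts (x : infN) : set nat := [set n | (val x : cantor_space) n].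

Definition subsets_of (x : infN) : set infN := [set y | elts y `<=` elts x].

Definition almost_disjoint (y z : infN) : Prop :=
  finite_set (elts y `&` elts z).

(* Main.v *)
Require Import Defs.
From mathcomp Require Import all_boot.
From mathcomp Require Import boolp classical_sets functions cardinality.
From mathcomp Require Import topology measurable_structure cantor.

(** Suppose E is the increasing union of equivalence relations F_i, and let the
Borel map phi_i into the Cantor space reduce F_i to equality.  It is enough to
find one infinite set x such that, for each i, the common values
phi_i y = phi_i z with y and z almost disjoint subsets of x all lie in a
countable set.  Indeed, hypothesis (i) gives inside every w included in x two
almost disjoint sets y E z E w, hence an i with phi_i y = phi_i z; as this
value determines the F_i-class of y, it determines the E-class of w.  So E has
only countably many classes on the subsets of x, against hypothesis (ii).

To find x, write [v, x] for the sets which start with the finite bit string v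
and which are included in x beyond v.  Borel sets are completely Ramsey
([borel_completely_ramsey], the Galvin-Prikry theorem), so a diagonal
construction ([fusion]) yields an infinite X on which each bit of phi_i y is a
function of a finite initial segment of y, the length of which does not depend
on y ([decide_bits]).  Hence phi_i, restricted to the subsets of X, extends
continuously to the finite ones: it has a limit value L_i(v) at each bit string
v, read as a finite set, and appending zeros to v does not change L_i(v).  A
second fusion ([separate_limits]) thins X to x so that, if v and w have the same
length and L_i(v) <> L_i(w), then phi_i y <> phi_i z for all y in [v, x] and z in
[w, x].

Now let y, z be almost disjoint subsets of x with phi_i y = phi_i z, and write
y|m for the first m bits of y.  For large m the strings y|m and z|m have the
same limit value.  Passing from m to m+1 appends a zero to at least one of them,
since m is not in both y and z; that limit value does not move, so the other one
does not move either.  The limit values are thus eventually constant, and by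
continuity phi_i y is their constant value, one of the countably many L_i(v)
([common_value_limit]). *)

Set Implicit Arguments.
Unset Strict Implicit.
Unset Printing Implicit Defensive.

Local Open Scope classical_set_scope.

(** * Infinite sets of naturals *)

Definition bit (x : infN) (n : nat) : bool := (val x : cantor_space) n.

Lemma infinite_natP (A : set nat) :
  infinite_set A <-> forall n, exists2 m, n <= m & A m.
Proof.
split=> [infA n|unbA /finite_seqP[s defA]].
  have /infinite_setN0[m [Am /negP]] := infinite_setD infA (finite_II n).
  by rewrite -leqNgt => le_nm; exists m.
have [m lt_m Am] := unbA (\max_(i <- s) i).+1.
have sm : m \in s by rewrite defA in Am.
by have := @leq_bigmax_seq _ s predT (fun i => i) m sm isT; rewrite leqNgt lt_m.
Qed.

Lemma bit_unbounded x n : exists2 m, n <= m & bit x m.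
Proof.
have /infinite_natP/(_ n)[m le_nm xm] : infinite_set (elts x).
  by have := valP x; rewrite inE.
by exists m.
Qed.

(** Infinite sets are built from propositional descriptions; the unbounded form
of infinitude is the one that the constructions below produce. *)
Lemma infN_of_set (A : set nat) :
  (forall n, exists2 m, n <= m & A m) -> exists x, forall n, bit x n <-> A n.
Proof.
move=> unbA; pose f : cantor_space := fun n => `[< A n >].
have inff : f \in infinite_subsets.
  rewrite inE; apply/infinite_natP => n.
  by have [m le_nm Am] := unbA n; exists m => //; apply/asboolP.
by exists (exist _ f inff) => n; rewrite /bit /=; split=> /asboolP.
Qed.

Lemma subsets_of_refl x : subsets_of x x.
Proof. by []. Qed.

Lemma subsets_of_trans x y z :
  subsets_of x y -> subsets_of y z -> subsets_of x z.
Proof. by move=> xy yz n /yz /xy. Qed.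

Lemma subset_tail m x : exists2 y, subsets_of x y & forall n, bit y n -> m <= n.
Proof.
have [n|y yP] := @infN_of_set [set n | m <= n /\ bit x n].
  have [k] := bit_unbounded x (maxn m n).
  by rewrite geq_max => /andP[le_mk le_nk] xk; exists k.
by exists y => n /yP[].
Qed.

(** * Ellentuck neighbourhoods and fusion *)

(** The basic open set [v, x] of the Ellentuck topology. *)
Definition nbhd (v : seq bool) (x : infN) : set infN :=
  [set y | (forall n, n < size v -> bit y n = nth false v n) /\
           (forall n, size v <= n -> bit y n -> bit x n)].

Definition decides v x (B : set infN) :=
  nbhd v x `<=` B \/ nbhd v x `<=` ~` B.

Definition completely_ramsey (B : set infN) :=
  forall v X, exists2 x, subsets_of X x & decides v x B.

Lemma nbhdS v x y :
  (forall n, size v <= n -> bit y n -> bit x n) -> nbhd v y `<=` nbhd v x.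
Proof. by move=> yx z [zv zy]; split=> // n vn /(zy n vn); apply: yx. Qed.

Lemma decidesS v x y B : (forall n, size v <= n -> bit y n -> bit x n) ->
  decides v x B -> decides v y B.
Proof.
by move=> /nbhdS yx [] xB; [left|right]; apply: subset_trans xB.
Qed.

Lemma nbhd_mkseq x y k : subsets_of x y -> nbhd (mkseq (bit y) k) x y.
Proof.
move=> xy; split=> n; rewrite size_mkseq; last by move=> _; apply: xy.
by move=> lt_nk; rewrite nth_mkseq.
Qed.

(** Diagonal construction.  A requirement [P k] that can be met by shrinking, and
that depends only on the part of the set above [k], can be met at once at
[k.+1] for all elements [k] of a single set: choose the elements one by one,
each from a set that meets the requirement raised by the element before it.
The requirement [P r] is met before any element is chosen; it serves to start
inductions whose first stage is not given by an element. *)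
Lemma fusion (P : nat -> infN -> Prop) (X : infN) (r : nat) :
  (forall k x y, P k x -> (forall n, k <= n -> bit y n -> bit x n) -> P k y) ->
  (forall k Y, subsets_of X Y -> exists2 x, subsets_of Y x & P k x) ->
  exists x, [/\ subsets_of X x, P r x & forall k, bit x k -> P k.+1 x].
Proof.
move=> P_hered P_dense.
have step (kY : nat * infN) : exists y, subsets_of X kY.2 ->
    [/\ subsets_of kY.2 y, P kY.1 y & forall n, bit y n -> kY.1 <= n].
  case: kY => k Y /=; have [XY|nXY] := pselect (subsets_of X Y); last by exists Y.
  have [x Yx Px] := P_dense k Y XY.
  have [y xy ky] := subset_tail k x.
  exists y => _; split=> //; first exact: subsets_of_trans xy.
  by apply: P_hered Px _ => n _; apply: xy.
have [F FP] := choice step.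
have someP (x : infN) : exists n, bit x n.
  by have [n _ xn] := bit_unbounded x 0; exists n.
(* Y i is the reservoir left before the i-th element, pt (Y i), is taken. *)
have [pt ptP] := choice someP.
pose Y := fix Y i := if i is j.+1 then F ((pt (Y j)).+1, Y j) else F (r, X).
have XY i : subsets_of X (Y i).
  elim: i => [|i IHi]; first by have [] := FP (r, X) (@subsets_of_refl X).
  by have [Yi _ _] := FP ((pt (Y i)).+1, Y i) IHi; apply: subsets_of_trans Yi.
have YSP i : [/\ subsets_of (Y i) (Y i.+1), P (pt (Y i)).+1 (Y i.+1)
    & forall n, bit (Y i.+1) n -> pt (Y i) < n].
  exact: (FP ((pt (Y i)).+1, Y i) (XY i)).
have Y_decr i j : i <= j -> subsets_of (Y i) (Y j).
  elim: j => [|j IHj]; first by rewrite leqn0 => /eqP->.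
  rewrite leq_eqVlt => /predU1P[->//|/IHj Yij].
  by have [Yj _ _] := YSP j; apply: subsets_of_trans Yj.
have pt_incr i j : i < j -> pt (Y i) < pt (Y j).
  by have [_ _ gtY] := YSP i; move=> /Y_decr Yij; apply/gtY/Yij/ptP.
have pt_ge i : i <= pt (Y i).
  by elim: i => // i IHi; apply: leq_ltn_trans IHi (pt_incr _ _ _).
have [n|x xP] := @infN_of_set [set n | exists i, n = pt (Y i)].
  by exists (pt (Y n)); last exists n.
exists x; split.
- by move=> n /xP[i ->]; apply/XY/ptP.
- have [_ PY0 _] := FP (r, X) (@subsets_of_refl X).
  by apply: P_hered PY0 _ => n _ /xP[i ->]; apply/(Y_decr 0)/ptP.
- move=> _ /xP[i ->]; have [_ PYi _] := YSP i.
  apply: P_hered PYi _ => n lt_in /xP[j def_n]; rewrite def_n in lt_in *.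
  apply/Y_decr/ptP; rewrite ltnNge; apply: contraL lt_in => le_ji.
  rewrite -leqNgt; move: le_ji; rewrite leq_eqVlt => /predU1P[->//|].
  by move=> /pt_incr/ltnW.
Qed.

(** There are finitely many bit strings of a given length, so a requirement of
[fusion] may quantify over all of them. *)
Lemma dense_fin (I : finType) (Q : I -> infN -> Prop) (X : infN) :
  (forall i x y, Q i x -> subsets_of x y -> Q i y) ->
  (forall i Y, subsets_of X Y -> exists2 x, subsets_of Y x & Q i x) ->
  forall Y, subsets_of X Y -> exists2 x, subsets_of Y x & forall i, Q i x.
Proof.
move=> Q_hered Q_dense Y XY.
suff [x Yx Qx]: exists2 x, subsets_of Y x & forall i, i \in enum I -> Q i x.
  by exists x => // i; apply: Qx; rewrite mem_enum.
elim: (enum I) => [|i s [x Yx Qx]]; first by exists Y.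
have [y xy Qy] := Q_dense i x (subsets_of_trans XY Yx).
exists y; first exact: subsets_of_trans xy.
by move=> j; rewrite inE => /predU1P[->//|/Qx/Q_hered]; apply.
Qed.

(** * The Galvin-Prikry theorem *)

Lemma completely_ramseyC B : completely_ramsey B -> completely_ramsey (~` B).
Proof.
move=> crB v X; have [x Xx dB] := crB v X; exists x => //.
by case: dB => dB; [right; rewrite setCK|left].
Qed.

Lemma completely_ramsey0 : completely_ramsey set0.
Proof. by move=> v X; exists X => //; right; rewrite setC0. Qed.

(** The characteristic string of length [a.+1] of the finite set coded by [v]
with [a] added. *)
Definition extend_by (v : seq bool) (a : nat) : seq bool :=
  mkseq (fun n => nth false v n || (n == a)) a.+1.

Lemma nbhd_extend_by v a x y : size v <= a -> bit y a ->
    (forall n, size v <= n < a -> ~~ bit y n) -> nbhd v x y ->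
  nbhd (extend_by v a) x y.
Proof.
move=> le_va ya y0 [yv yx]; split=> n; rewrite size_mkseq => n_a; last first.
  by apply: yx; apply: leq_trans le_va (ltnW n_a).
rewrite nth_mkseq //; have [lt_nv|le_vn] := ltnP n (size v).
  by rewrite yv // ltn_eqF ?orbF // (leq_trans lt_nv).
rewrite nth_default //=; have [->//|neq_na] := eqVneq n a.
by apply/negbTE/y0; rewrite le_vn ltn_neqAle neq_na -ltnS.
Qed.

Lemma extend_by_mkseq (y : infN) k a : k <= a -> bit y a ->
    (forall n, k <= n < a -> ~~ bit y n) ->
  extend_by (mkseq (bit y) k) a = mkseq (bit y) a.+1.
Proof.
move=> le_ka ya y0.
have [yk _] : nbhd (extend_by (mkseq (bit y) k) a) y y.
  by apply: nbhd_extend_by; rewrite ?size_mkseq //; apply: nbhd_mkseq.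
apply: (@eq_from_nth _ false); rewrite !size_mkseq // => n lt_na.
by rewrite -yk ?size_mkseq // nth_mkseq.
Qed.

(** Nash-Williams' combinatorial forcing: [v, x] is accepted when it is included
in [B], and rejected when no smaller set makes [v] accepted. *)
Section AcceptReject.
Variable B : set infN.

Definition rejects v x := forall y, subsets_of x y -> ~ nbhd v y `<=` B.

Definition accepts_or_rejects v x := nbhd v x `<=` B \/ rejects v x.

Lemma accepts_or_rejectsS v x y : (forall n, size v <= n -> bit y n -> bit x n) ->
  accepts_or_rejects v x -> accepts_or_rejects v y.
Proof.
move=> yx [xB|rej]; [left|right].
  by apply: subset_trans xB; apply: nbhdS.
move=> z yz zB; have [t zt vt] := subset_tail (size v) z.
apply: (rej t).
  by move=> n tn; apply: yx; [apply: vt|apply/yz/zt].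
by apply: subset_trans zB; apply: nbhdS => n _; apply: zt.
Qed.

(** If infinitely many [a] gave an accepted extension of [v], the set of these
[a] would make [v] itself accepted, because a member of the neighbourhood has
a first element above [v].  So when [v] is rejected, almost all of its one-point
extensions are. *)
Lemma rejects_extend v X Y :
    (forall a w, bit X a -> size w = a.+1 -> accepts_or_rejects w X) ->
    subsets_of X Y -> rejects v X ->
  exists2 x, subsets_of Y x &
    forall a, bit x a -> size v <= a -> rejects (extend_by v a) X.
Proof.
move=> decX XY rejv.
pose A := [set a | bit Y a /\ (size v <= a /\ ~ rejects (extend_by v a) X)].
have [unbA|] := pselect (forall n, exists2 m, n <= m & A m).
  have [x xP] := infN_of_set unbA.
  have Yx : subsets_of Y x by move=> n /xP[].
  case: (rejv x (subsets_of_trans XY Yx)) => y nyx.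
  have exa : exists a, (size v <= a) && bit y a.
    by have [a va ya] := bit_unbounded y (size v); exists a; rewrite va.
  case: (ex_minnP exa) => a /andP[va ya] min_a.
  have /xP[Ya [_ nrej]] : bit x a by apply: nyx.2.
  have [|//] := decX a (extend_by v a) (XY a Ya) (size_mkseq _ _).
  apply; apply: nbhd_extend_by => //.
    move=> n /andP[vn lt_na]; apply: contraL lt_na => yn.
    by rewrite -leqNgt min_a ?vn.
  by apply: nbhdS nyx => n _ /Yx /XY.
move=> /existsNP[N NA]; have [x Yx Nx] := subset_tail N Y.
exists x => // a xa va; apply: contrapT => nrej; apply: NA.
by exists a; [exact: Nx|split; [exact: Yx|]].
Qed.

End AcceptReject.

(** If no smaller set makes [u] accepted for the union, fuse a set X2 along which
rejection passes from each string to its one-point extensions and each [B n]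
is eventually decided.  A member y of [u, X2] has only rejected initial
segments, so whenever one of these decides [B n] it does so negatively.  This
treats countable unions directly, with no separate argument for open sets. *)
Lemma completely_ramsey_bigcup (B : nat -> set infN) :
  (forall n, completely_ramsey (B n)) -> completely_ramsey (\bigcup_n B n).
Proof.
move=> crB u X; set C := \bigcup_n B n.
(* X1: every string ending at one of its elements is accepted or rejected. *)
have [||X1 [XX1 decu decX1]] := @fusion
  (fun k x => forall v : k.-tuple bool, accepts_or_rejects C v x) X (size u).
- move=> k x y Px yx v; apply: accepts_or_rejectsS (Px v) => n.
  by rewrite size_tuple; apply: yx.
- move=> k; apply: dense_fin => [v x y Px xy|v Y _].
    by apply: accepts_or_rejectsS Px => n _; apply: xy.
  have [[x Yx xC]|nY] :=
    pselect (exists2 x, subsets_of Y x & nbhd v x `<=` C).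
    by exists x => //; left.
  by exists Y => //; right=> x Yx xC; apply: nY; exists x.
have {}decX1 a w : bit X1 a -> size w = a.+1 -> accepts_or_rejects C w X1.
  by move=> X1a /eqP sz_w; apply: (decX1 a X1a (Tuple sz_w)).
have [uC|rej_u] := decu (in_tuple u); first by exists X1 => //; left.
(* The index n ranges over 'I_k.+1 rather than 'I_k so that the first half of
   the requirement is not void at k = 0. *)
pose Q k (vn : k.-tuple bool * 'I_k.+1) x :=
  (rejects C vn.1 X1 ->
     forall a, bit x a -> k <= a -> rejects C (extend_by vn.1 a) X1) /\
  decides vn.1 x (B vn.2).
have [||X2 [X12 QX2u QX2]] :=
  @fusion (fun k x => forall vn, @Q k vn x) X1 (size u).
- move=> k x y Qx yx vn; have [Qx1 Qx2] := Qx vn; split.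
    by move=> /Qx1 rej a ya ka; apply: rej => //; apply: yx.
  by apply: decidesS Qx2 => n; rewrite size_tuple; apply: yx.
- move=> k; apply: dense_fin => [[v n] x y [/= Qx1 Qx2] xy|[v n] Y XY].
    split=> /=; first by move=> /Qx1 rej a /xy xa; apply: rej.
    by apply: decidesS Qx2 => m _; apply: xy.
  have [x Yx decx] := crB n v Y.
  have [rejv|nrejv] := pselect (rejects C v X1); last by exists x.
  have [y xy rej_ext] := rejects_extend decX1 (subsets_of_trans XY Yx) rejv.
  exists y; first exact: subsets_of_trans xy.
  split=> /=; last by apply: decidesS decx => m _; apply: xy.
  by move=> _ a ya ka; apply: rej_ext; rewrite ?size_tuple.
exists X2; first exact: subsets_of_trans X12.
right=> y [yu yX2] [n _ yBn].
pose G k := forall a, bit X2 a -> k <= a ->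
  rejects C (extend_by (mkseq (bit y) k) a) X1.
have rej_ext a k : size u <= a -> G k -> k <= a -> bit y a ->
    (forall n, k <= n < a -> ~~ bit y n) -> rejects C (mkseq (bit y) a.+1) X1.
  move=> ua Gk ka ya y0; rewrite -(extend_by_mkseq ka ya y0).
  by apply: Gk => //; apply: yX2.
have def_u : mkseq (bit y) (size u) = u.
  apply: (@eq_from_nth _ false); rewrite size_mkseq // => j lt_ju.
  by rewrite nth_mkseq // yu.
(* G k starts to hold at size u and again just after each element of y, so below
   any bound the last such k is followed by no element of y. *)
have exG d : exists k, [/\ k <= size u + d, G k &
    forall n, k <= n < size u + d -> ~~ bit y n].
  elim: d => [|d [k [km Gk y0]]].
    rewrite addn0; exists (size u); split=> // [|j]; last first.
      by rewrite leqNgt andNb.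
    by rewrite /G def_u; have [/(_ rej_u)] := QX2u (in_tuple u, ord0).
  rewrite addnS; move: km y0; set m := size u + d => km y0.
  have um : size u <= m := leq_addr _ _.
  have [ym|nym] := boolP (bit y m).
    exists m.+1; split=> // [a X2a ma|j]; last by rewrite leqNgt andNb.
    have szv : size (mkseq (bit y) m.+1) == m.+1 by rewrite size_mkseq.
    have [rej _] := QX2 m (yX2 m um ym) (Tuple szv, ord0).
    by apply: rej => //=; apply: rej_ext ym y0.
  exists k; split=> //; first exact: leqW.
  move=> j /andP[kj]; rewrite ltnS leq_eqVlt => /predU1P[->//|jm].
  by apply: y0; rewrite kj.
have [a] := bit_unbounded y (maxn n (size u)).
rewrite geq_max => /andP[na ua] ya.
have [k []] := exG (a - size u); rewrite subnKC // => ka Gk y0.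
have rej := rej_ext a k ua Gk ka ya y0.
have szv : size (mkseq (bit y) a.+1) == a.+1 by rewrite size_mkseq.
have lt_na : n < a.+2 by rewrite ltnS (leq_trans na).
have [_ /= [vB|vnB]] := QX2 a (yX2 a ua ya) (Tuple szv, Ordinal lt_na).
  by apply: (rej X2 X12) => z /vB Bz; exists n.
apply: vnB yBn; split=> j; rewrite size_mkseq; first by move=> ja; rewrite nth_mkseq.
by move=> /ltnW/(leq_trans ua); apply: yX2.
Qed.

Definition cylinder (w : seq bool) : set infN :=
  [set y | forall n, n < size w -> bit y n = nth false w n].

Lemma completely_ramsey_cylinder w : completely_ramsey (cylinder w).
Proof.
move=> v X; have [x Xx wx] := subset_tail (size w) X.
exists x => //.
have bit_v y n : nbhd v x y -> n < size w -> bit y n = nth false v n.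
  move=> [yv yx] nw; have [/yv//|vn] := ltnP n (size v).
  rewrite nth_default //; apply: contraTF nw => yn.
  by rewrite -leqNgt; apply/wx/yx.
have [vw|nvw] :=
  pselect (forall n, n < size w -> nth false v n = nth false w n).
  by left=> y yvx n nw; rewrite (bit_v y) // vw.
by right=> y yvx yw; apply: nvw => n nw; rewrite -yw // (bit_v y).
Qed.

(** Otherwise pick in each cylinder around [y] a point outside [U]; these points
converge to [y] coordinatewise, hence in the product topology. *)
Lemma open_cylinder (U : set infN) y :
  open U -> U y -> exists k, cylinder (mkseq (bit y) k) `<=` U.
Proof.
move=> [V openV <-] Vy; apply: contrapT => /forallNP noK.
have notV k : exists z, cylinder (mkseq (bit y) k) z /\ ~ V (val z).
  have /existsNP[z /not_implyP[yz nVz]] := noK k.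
  by exists z.
have [z zP] := choice notV.
have zy : (fun k => val (z k)) @ \oo --> (val y : cantor_space).
  apply/cvg_sup => n W [_ [[T _ <-] Ty TW]].
  exists n.+1 => // k /= nk; apply: TW => /=.
  suff -> : val (z k) n = val y n by [].
  by have := (zP k).1 n; rewrite size_mkseq => /(_ nk); rewrite nth_mkseq.
have [k _ Vk] := zy V (open_nbhs_nbhs (conj openV Vy)).
by apply: (zP k).2; apply: (Vk k) => /=.
Qed.

Lemma completely_ramsey_open (U : set infN) : open U -> completely_ramsey U.
Proof.
move=> openU.
pose V i : set infN := if unpickle i is Some w then
  [set y | cylinder w `<=` U /\ cylinder w y] else set0.
have -> : U = \bigcup_i V i.
  apply/seteqP; split=> [y Uy|y [i _]]; last first.
    by rewrite /V; case: unpickle => // w [wU] /wU.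
  have [k kU] := open_cylinder openU Uy.
  exists (pickle (mkseq (bit y) k)) => //; rewrite /V pickleK; split=> // n.
  by rewrite size_mkseq => nk; rewrite nth_mkseq.
apply: completely_ramsey_bigcup => i; rewrite /V.
case: unpickle => [w|]; last exact: completely_ramsey0.
have [wU|nwU] := pselect (cylinder w `<=` U).
  rewrite (_ : [set y | _] = cylinder w); first exact: completely_ramsey_cylinder.
  by apply/seteqP; split=> y // [].
rewrite (_ : [set y | _] = set0); first exact: completely_ramsey0.
by apply/seteqP; split=> y // [].
Qed.

Lemma borel_completely_ramsey (B : set infN) : borel B -> completely_ramsey B.
Proof.
apply: smallest_sub; last exact: completely_ramsey_open.
split; first exact: completely_ramsey0.
  by move=> A; rewrite setTD; apply: completely_ramseyC.
exact: completely_ramsey_bigcup.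
Qed.

(** * Limit values of Borel maps at finite sets *)

Lemma decide_bits (phi : nat -> infN -> cantor_space) (X : infN) :
  (forall i j, completely_ramsey [set y | phi i y j]) ->
  exists2 x, subsets_of X x & forall k v i j, bit x k -> size v = k.+1 ->
    i <= k -> j <= k -> decides v x [set y | phi i y j].
Proof.
move=> phiR.
pose Q k (vij : k.-tuple bool * ('I_k * 'I_k)) x :=
  decides vij.1 x [set y | phi vij.2.1 y vij.2.2].
have [||x [Xx _ Qx]] := @fusion (fun k x => forall vij, @Q k vij x) X 0.
- move=> k x y Qx yx vij; apply: decidesS (Qx vij) => n.
  by rewrite size_tuple; apply: yx.
- move=> k; apply: dense_fin => [[v [i j]] x y Qx xy|[v [i j]] Y _].
    by apply: decidesS Qx => n _; apply: xy.
  exact: phiR.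
exists x => // k v i j xk /eqP szv ik jk.
have {}ik : i < k.+1 by []. have {}jk : j < k.+1 by [].
exact: (Qx k xk (Tuple szv, (Ordinal ik, Ordinal jk))).
Qed.

Section LimitValues.
Variables (phi : nat -> infN -> cantor_space) (X : infN).
Hypothesis phi_dec : forall k v i j, bit X k -> size v = k.+1 ->
  i <= k -> j <= k -> decides v X [set y | phi i y j].

(** The members of [v, X] close to the finite set coded by [v]: their elements
beyond [v] are at least [m]. *)
Definition far_nbhd v m : set infN :=
  [set y | nbhd v X y /\ forall n, size v <= n -> bit y n -> m <= n].

Lemma far_nbhd_meet v m1 m2 : exists y, far_nbhd v m1 y /\ far_nbhd v m2 y.
Proof.
pose A := [set n | if n < size v then nth false v n = true else
                   maxn m1 m2 <= n /\ bit X n].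
have [n|y yP] := @infN_of_set A.
  have [k] := bit_unbounded X (maxn n (maxn (size v) (maxn m1 m2))).
  rewrite !geq_max => /and4P[nk vk m1k m2k] Xk.
  by exists k => //=; rewrite /A /= ltnNge vk geq_max m1k.
have y_lo n : n < size v -> bit y n = nth false v n.
  by move=> nv; apply/idP/idP => [/yP|vn]; last apply/yP; rewrite /A /= nv.
have y_hi n : size v <= n -> bit y n -> maxn m1 m2 <= n /\ bit X n.
  by move=> vn /yP; rewrite /A /= ltnNge vn.
by exists y; split; (split; first by split=> // n vn /(y_hi n vn)[]) => n vn
  /(y_hi n vn)[]; rewrite geq_max => /andP[].
Qed.

(** The continuous extension of [phi i] to finite sets. *)
Definition limit_value i v : cantor_space := fun j =>
  `[< exists m, forall y, far_nbhd v m y -> phi i y j >].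

(** Well defined because any two of the neighbourhoods [far_nbhd v m] meet. *)
Lemma limit_value_unique i v j m b :
  (forall y, far_nbhd v m y -> phi i y j = b) -> limit_value i v j = b.
Proof.
move=> phib; apply/asboolP/idP => [[m' phi1]|b1]; last first.
  by exists m => y /phib->.
by have [y [/phib <- /phi1]] := far_nbhd_meet v m m'.
Qed.

Lemma limit_value_nbhd k v i j y : bit X k -> size v = k.+1 ->
  i <= k -> j <= k -> nbhd v X y -> phi i y j = limit_value i v j.
Proof.
move=> Xk szv ik jk; case: (phi_dec Xk szv ik jk) => vP vy.
  by rewrite (vP y vy); symmetry; apply: (@limit_value_unique _ _ _ 0) => z [/vP].
rewrite (negbTE (introN idP (vP y vy))); symmetry.
by apply: (@limit_value_unique _ _ _ 0) => z [/vP/negP/negbTE].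
Qed.

(** Continuity at the finite set coded by [v]: pad [v] with zeros up to a string
long enough to decide the bit. *)
Lemma limit_value_far i v j :
  exists m, forall y, far_nbhd v m y -> phi i y j = limit_value i v j.
Proof.
have [k] := bit_unbounded X (maxn (size v) (maxn i j)).
rewrite !geq_max => /and3P[vk ik jk] Xk.
pose w := v ++ nseq (k.+1 - size v) false.
have szw : size w = k.+1 by rewrite size_cat size_nseq subnKC // leqW.
have far_w y : far_nbhd v k.+1 y -> nbhd w X y.
  move=> [[yv yX] ky]; split=> n; rewrite szw => n_k; last first.
    by apply: yX; apply: leq_trans vk (ltnW n_k).
  rewrite nth_cat nth_nseq if_same; case: ltnP => [/yv//|vn].
  by apply: contraTF n_k => /(ky n vn); rewrite leqNgt.
exists k.+1 => y /far_w/(limit_value_nbhd Xk szw ik jk) ->; symmetry.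
by apply: (@limit_value_unique _ _ _ k.+1) => z /far_w/(limit_value_nbhd Xk szw ik jk).
Qed.

Lemma limit_value_rcons0 i v :
  limit_value i (rcons v false) = limit_value i v.
Proof.
apply/funext => j; have [m phim] := limit_value_far i v j.
apply: (@limit_value_unique _ _ _ m) => y [[yv yX] my].
rewrite size_rcons in yv yX my; apply: phim.
have yv0 n : size v <= n -> bit y n -> size v < n.
  rewrite leq_eqVlt => /predU1P[<-|//].
  by rewrite yv // nth_rcons ltnn eqxx.
split; first split.
- by move=> n nv; rewrite yv ?leqW // nth_rcons nv.
- by move=> n vn yn; apply: yX => //; apply: yv0.
- by move=> n vn yn; apply: my => //; apply: yv0.
Qed.

(** Two distinct limit values differ at some bit; keeping only large elements
freezes this bit at its limit values, which separates [phi i] on the two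
neighbourhoods. *)
Lemma separate_limits : exists2 x, subsets_of X x &
  forall k v w i y z, bit x k -> size v = k.+1 -> size w = k.+1 -> i <= k ->
    nbhd v x y -> nbhd w x z -> phi i y = phi i z ->
  limit_value i v = limit_value i w.
Proof.
pose Q k (vwi : k.-tuple bool * (k.-tuple bool * 'I_k)) x :=
  let: (v, (w, i)) := vwi in forall y z,
    nbhd v x y -> nbhd w x z -> phi i y = phi i z ->
  limit_value i v = limit_value i w.
have Q_hered k vwi x y : @Q k vwi x ->
    (forall n, k <= n -> bit y n -> bit x n) -> Q k vwi y.
  case: vwi => v [w i] Qx yx y1 y2 vy1 wy2.
  by apply: Qx; [move: vy1|move: wy2]; apply: nbhdS;
    rewrite size_tuple; apply: yx.
have [||x [Xx _ Qx]] := @fusion (fun k x => forall vwi, @Q k vwi x) X 0.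
- by move=> k x y Qx yx vwi; apply: Q_hered yx.
- move=> k; apply: dense_fin => [vwi x y Qx xy|[v [w i]] Y XY].
    by apply: Q_hered Qx _ => n _; apply: xy.
  have [eqL|neqL] := pselect (limit_value i v = limit_value i w).
    by exists Y.
  have /existsNP[j neqj] : ~ limit_value i v =1 limit_value i w.
    by move=> /funext.
  have [m1 Lv] := limit_value_far i v j.
  have [m2 Lw] := limit_value_far i w j.
  have [x Yx mx] := subset_tail (maxn m1 m2) Y.
  have Xx := subsets_of_trans XY Yx.
  exists x => // y z vy wz eq_yz; case: neqj.
  rewrite -(Lv y) -?(Lw z) ?eq_yz //.
    split; first by apply: nbhdS wz => n _; apply: Xx.
    by move=> n wn /(wz.2 n wn)/mx; rewrite geq_max => /andP[].
  split; first by apply: nbhdS vy => n _; apply: Xx.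
  by move=> n vn /(vy.2 n vn)/mx; rewrite geq_max => /andP[].
exists x => // k v w i y z xk /eqP szv /eqP szw ik.
have {}ik : i < k.+1 by [].
exact: (Qx k xk (Tuple szv, (Tuple szw, Ordinal ik))).
Qed.

(** Once [n] is beyond the intersection of [y] and [z], one of the two segments
grows by a zero when bit [n] is added, so its limit value stays; separation
carries this over to the other one. *)
Lemma common_value_limit x :
  subsets_of X x ->
  (forall k v w i y z, bit x k -> size v = k.+1 -> size w = k.+1 -> i <= k ->
    nbhd v x y -> nbhd w x z -> phi i y = phi i z ->
    limit_value i v = limit_value i w) ->
  forall i y z, subsets_of x y -> subsets_of x z -> almost_disjoint y z ->
    phi i y = phi i z -> exists v, phi i y = limit_value i v.
Proof.
move=> Xx sep i y z xy xz disj eq_yz.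
have [N NP] : exists N, forall n, bit y n -> bit z n -> n < N.
  apply: contrapT => /forallNP noN; move: disj; apply/infinite_natP => n.
  have /existsNP[m /not_implyP[ym /not_implyP[zm /negP]]] := noN n.
  by rewrite -leqNgt => nm; exists m.
have [k] := bit_unbounded x (maxn N i); rewrite geq_max => /andP[Nk ik] xk.
pose Ly m := limit_value i (mkseq (bit y) m).
pose Lz m := limit_value i (mkseq (bit z) m).
have LyLz m : bit x m -> i <= m -> Ly m.+1 = Lz m.+1.
  by move=> xm im; apply: (sep m _ _ i y z); rewrite ?size_mkseq //;
    apply: nbhd_mkseq.
have Ly_pad m : ~~ bit y m -> Ly m.+1 = Ly m.
  by rewrite /Ly mkseqS => /negbTE->; apply: limit_value_rcons0.
have Lz_pad m : ~~ bit z m -> Lz m.+1 = Lz m.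
  by rewrite /Lz mkseqS => /negbTE->; apply: limit_value_rcons0.
(* From k on, elements are outside the intersection and separation applies
   to index i. *)
have Lconst d : Ly (k.+1 + d) = Ly k.+1 /\ Lz (k.+1 + d) = Ly k.+1.
  elim: d => [|d]; first by rewrite addn0; split=> //; rewrite LyLz.
  rewrite addnS; have km : k < k.+1 + d by rewrite leq_addr.
  move: (k.+1 + d) km => m km [IHy IHz].
  have im : i <= m := leq_trans ik (ltnW km).
  have [ym|nym] := boolP (bit y m); have [zm|nzm] := boolP (bit z m).
  - by have := NP m ym zm; rewrite ltnNge (leq_trans Nk (ltnW km)).
  - by rewrite (LyLz m (xy m ym) im) Lz_pad.
  - by rewrite -(LyLz m (xz m zm) im) Ly_pad.
  - by rewrite Ly_pad // Lz_pad.
exists (mkseq (bit y) k.+1); apply/funext => j.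
have [m] := bit_unbounded X (maxn k.+1 j); rewrite geq_max => /andP[km jm] Xm.
have [Lm _] := Lconst (m.+1 - k.+1); rewrite subnKC in Lm; last exact: leqW.
transitivity (Ly m.+1 j); last by rewrite Lm.
apply: (limit_value_nbhd Xm) => //; first by rewrite size_mkseq.
  exact: leq_trans ik (ltnW km).
exact/nbhd_mkseq/(subsets_of_trans Xx).
Qed.

End LimitValues.

Lemma open_coordinate j : open [set c : cantor_space | c j].
Proof.
have cont : continuous (fun c : cantor_space => c j).
  exact: (@proj_continuous nat (fun=> bool) j).
exact: (continuousP _).1 cont [set b : bool | b] (discrete_open _).
Qed.

(** Together with the countability of the set of pairs (i, v), this is all that the
theorem needs about Borel maps. *)
Lemma almost_disjoint_fibers (phi : nat -> infN -> cantor_space) :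
  (forall i, borel_map (phi i)) ->
  exists x (L : nat -> seq bool -> cantor_space), forall i y z,
    subsets_of x y -> subsets_of x z -> almost_disjoint y z ->
    phi i y = phi i z -> exists v, phi i y = L i v.
Proof.
move=> phiB.
have [N|X0 _] := @infN_of_set setT; first by exists N.
have [i j|X _ decX] := @decide_bits phi X0.
  apply: borel_completely_ramsey; apply: (phiB i [set c | c j]).
  by apply: sub_gen_smallest; apply: open_coordinate.
have [x Xx sep] := separate_limits decX.
exists x, (limit_value phi X); exact: common_value_limit.
Qed.

(** * Hypersmooth relations *)

Theorem theorem1p1 (E : infN -> infN -> Prop) (hE : Equivalence E)
  (h_disj : forall x : infN, exists y z : infN,
     subsets_of x y /\ subsets_of x z /\ almost_disjoint y z /\ E y z /\ E z x)
  (h_unctbl : forall x : infN,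
     ~ countable (restriction_classes E (subsets_of x))) :
  ~ hypersmooth E.
Proof.
move=> [F [Fsm _ EF]].
have [Esym Etrans] := (@Equivalence_Symmetric _ _ hE, @Equivalence_Transitive _ _ hE).
have red i : exists f : infN -> cantor_space,
    borel_map f /\ forall a b, F i a b <-> f a = f b.
  by have [_ [f fB fP]] := Fsm i; exists f.
have [phi phiP] := choice red.
have [x [L xL]] := almost_disjoint_fibers (fun i => (phiP i).1).
apply: (h_unctbl x).
(* Every E-class on the subsets of x is indexed by some pair (i, v). *)
pose class_at (iv : nat * seq bool) := [set z | subsets_of x z /\
  exists2 y, E z y & phi iv.1 y = L iv.1 iv.2].
apply: (@sub_countable _ _ _ (range class_at)); last first.
  exact: sub_countable (card_image_le _ _) (countableP _).
apply: subset_card_le => _ [w xw <-].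
have [y [z [wy [wz [yz_disj [Eyz Ezw]]]]]] := h_disj w.
have /EF[i /(phiP i).2 phi_yz] := Eyz.
have [v phi_y] := xL i y z (subsets_of_trans xw wy) (subsets_of_trans xw wz)
  yz_disj phi_yz.
have Ewy : E w y by exact: Esym (Etrans _ _ _ Eyz Ezw).
exists (i, v) => //; apply/seteqP; split=> t [xt].
  move=> [y' Ety' /= phi_y']; split=> //.
  have Eyy' : E y y' by apply/EF; exists i; apply/(phiP i).2; rewrite phi_y'.
  exact: Etrans Ewy (Etrans _ _ _ Eyy' (Esym _ _ Ety')).
by move=> Ewt; split=> //; exists y => //; exact: Etrans (Esym _ _ Ewt) Ewy.
Qed.
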